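(* Let $M$ be a monoid which is factorized by its submonoids $A$ and $B$. Then the assignment $q \longmapsto \mathrm{Ker}(q)$ yields an isomorphism of pointed sets $$\mathcal{D}_l^{u,B}(M,A) \simeq \mathsf{FAC}(A/M),$$ where $\mathcal{D}_l^{u,B}(M,A)$ has base point $l^B_A$ and $\mathsf{FAC}(A/M)$ has base point $B$.
   Context: Let $1_M$ be the unit of $M$ and $U(A)$ the group of invertible elements of $A$. A pair $(A,B)$ of submonoids of $M$ is a factorization of $M$ ($M$ is factorized by $A$ and $B$) if the multiplication map $A \times B \to M$, $(a,b)\mapsto ab$, is bijective. $\mathsf{FAC}(A/M)$ is the set of submonoids $C$ of $M$ such that $(A,C)$ is a factorization of $M$. For a factorization $(A,B)$, the map $l^B_A : M \to A$ sends $m = ab$ (unique decomposition with $a\in A$, $b \in B$) to $a$. $\mathcal{D}_l(M,A)$ denotes the set of (left) descent 1-cocycles, i.e. maps of sets $q : M \to A$ such that (L1) $q(a) = a$ for all $a \in A$; (L2) $q(am) = a\,q(m)$ for all $a \in A$, $m \in M$; (L3) $q(m_1 m_2) = q(m_1 q(m_2))$ for all $m_1, m_2 \in M$. $\mathcal{D}_l^{u,B}(M,A) = \{q \in \mathcal{D}_l(M,A) : q(B) \subseteq U(A)\}$; it contains $l^B_A$. Finally $\mathrm{Ker}(q) = \{m \in M : q(m) = 1_M\}$. *)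

(* Defs.v *)
From mathcomp Require Import all_boot.
From mathcomp Require Import mathcomp_extra boolp classical_sets functions.

Set Implicit Arguments.
Unset Strict Implicit.
Unset Printing Implicit Defensive.

Local Open Scope classical_set_scope.
Local Open Scope group_scope.

Section Factorizations.
Variable M : monoidType.
Implicit Types (A B C : set M) (q : M -> M).

Definition submonoid A : Prop := monoid_closed (mem A).

Definition factorization A B : Prop :=
  [/\ submonoid A, submonoid B &
      set_bij (A `*` B) [set: M] (fun p : M * M => p.1 * p.2)].

Definition FAC A : set (set M) := [set C | factorization A C].

(* The inverse is taken in A, so that this is U(A) and not U(M) `&` A. *)
Definition submonoid_units A : set M :=
  [set u | A u /\ exists2 v, A v & u * v = 1 /\ v * u = 1].

(* The default value 1 of xget is never reached when (A, B) is a
   factorization. *)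
Definition left_component A B (m : M) : M :=
  xget 1 [set a | A a /\ exists2 b, B b & m = a * b].

(* A map M -> A is represented by a map M -> M with values in A. *)
Definition left_descent_cocycle A : set (M -> M) :=
  [set q | [/\ set_fun [set: M] A q,
               forall a, A a -> q a = a,
               forall a m, A a -> q (a * m) = a * q m &
               forall m1 m2, q (m1 * m2) = q (m1 * q m2)]].

Definition left_descent_cocycle_unit_on A B : set (M -> M) :=
  [set q | left_descent_cocycle A q /\ q @` B `<=` submonoid_units A].

Definition cocycle_ker q : set M := [set m | q m = 1].

End Factorizations.

(* f restricts to an isomorphism of pointed sets (X, x0) -> (Y, y0). *)
Definition pointed_set_iso (T U : Type) (X : set T) (x0 : T)
    (Y : set U) (y0 : U) (f : T -> U) : Prop :=
  [/\ X x0, Y y0, set_bij X Y f & f x0 = y0].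

(* Main.v *)
Require Import Defs.
From mathcomp Require Import all_boot.
From mathcomp Require Import mathcomp_extra boolp classical_sets functions.

(** The kernel recovers [q] because [q (a * c) = a] for [a] in [A] and [c] in
    [Ker q].  A cocycle [q] with unit values on [B] makes [(A, Ker q)] a
    factorization, since [a * b = (a * q b) * ((q b)^-1 * b)].  Conversely, if
    [(A, C)] is a factorization, then its left component is a cocycle with
    kernel [C]; it is invertible at [b] in [B] because comparing the
    decompositions [b = a * c] along [(A, C)] and [c = a' * b'] along [(A, B)]
    forces [a'] to be the inverse of [a]. *)

Set Implicit Arguments.
Unset Strict Implicit.
Unset Printing Implicit Defensive.

Local Open Scope classical_set_scope.
Local Open Scope group_scope.

Section Factorizations.
Variable M : monoidType.
Implicit Types (A B C : set M) (q : M -> M).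

Lemma submonoidE A :
  submonoid A <-> A 1 /\ forall x y, A x -> A y -> A (x * y).
Proof.
split=> [[/set_mem A1 AM]|[A1 AM]]; split.
- exact: A1.
- by move=> x y Ax Ay; apply/set_mem/AM; apply/mem_set.
- exact/mem_set.
- by move=> x y /set_mem Ax /set_mem Ay; apply/mem_set/AM.
Qed.

Lemma factorizationE A B :
  factorization A B <->
  [/\ submonoid A, submonoid B,
      forall m, exists a b, [/\ A a, B b & m = a * b] &
      forall a b a' b', A a -> B b -> A a' -> B b' ->
        a * b = a' * b' -> a = a' /\ b = b'].
Proof.
split=> [[sA sB [_ inj surj]]|[sA sB surj inj]]; split=> //.
- move=> m; have [[a b] [/= Aa Bb] <-] := surj m I.
  by exists a, b.
- move=> a b a' b' Aa Bb Aa' Bb' e.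
  have [] // : (a, b) = (a', b').
  by apply: inj => //; apply/mem_set.
- split=> //.
  + move=> [a b] [a' b'] /set_mem[/= Aa Bb] /set_mem[/= Aa' Bb'] /= e.
    by have [-> ->] := inj _ _ _ _ Aa Bb Aa' Bb' e.
  + by move=> m _; have [a [b [Aa Bb ->]]] := surj m; exists (a, b).
Qed.

Lemma left_componentM A B a b : factorization A B -> A a -> B b ->
  left_component A B (a * b) = a.
Proof.
move=> /factorizationE[_ _ _ inj] Aa Bb; apply: xget_unique.
  by split=> //; exists b.
move=> a' [Aa' [b' Bb' e]].
by have [-> _] := inj _ _ _ _ Aa Bb Aa' Bb' e.
Qed.

(** The last cocycle law rests on [C] being closed under products: if [m2 = a * c] and
    [m1 * a = a' * c'], then [m1 * m2 = a' * (c' * c)] has the same left component as [m1 * a]. *)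
Lemma left_component_cocycle A C : factorization A C ->
  left_descent_cocycle A (left_component A C).
Proof.
move=> facAC; have lE := left_componentM facAC.
have /factorizationE[/submonoidE[A1 AM] /submonoidE[C1 CM] dec _] := facAC.
split.
- by move=> m _; have [a [c [Aa Cc ->]]] := dec m; rewrite lE.
- by move=> a Aa; rewrite -[X in left_component _ _ X]mulg1 lE.
- move=> a m Aa; have [a' [c [Aa' Cc ->]]] := dec m.
  by rewrite mulgA !lE //; apply: AM.
- move=> m1 m2; have [a [c [Aa Cc ->]]] := dec m2.
  rewrite [left_component A C (a * c)]lE // mulgA.
  have [a' [c' [Aa' Cc' ->]]] := dec (m1 * a).
  by rewrite -mulgA !lE //; apply: CM.
Qed.

Lemma left_component_units A B C : factorization A B -> factorization A C ->
  left_component A C @` B `<=` submonoid_units A.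
Proof.
move=> facAB facAC _ [b Bb <-].
have /factorizationE[/submonoidE[A1 AM] _ decB injB] := facAB.
have /factorizationE[_ _ decC injC] := facAC.
have [a [c [Aa Cc bE]]] := decC b.
have [a' [b' [Aa' Bb' cE]]] := decB c.
rewrite bE left_componentM //; split=> //; exists a' => //.
(* Both [1 * b] and [(a * a') * b'] decompose [b] along [(A, B)]. *)
have [aa' bb'] : 1 = a * a' /\ b = b'.
  by apply: injB => //; [exact: AM | rewrite mul1g -mulgA -cE].
(* For the other side of the inverse, [a' * b = a' * b' = c] gives two decompositions of [c] along
   [(A, C)]. *)
have e : a' * a * c = 1 * c by rewrite -mulgA -bE bb' -cE mul1g.
by have [-> _] := injC _ _ _ _ (AM _ _ Aa' Aa) Cc A1 Cc e.
Qed.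

Lemma cocycle_ker_left_component A C : factorization A C ->
  cocycle_ker (left_component A C) = C.
Proof.
move=> facAC.
have /factorizationE[/submonoidE[A1 _] _ dec _] := facAC.
apply/seteqP; split=> [m|c Cc]; rewrite /cocycle_ker /=.
  have [a [c [Aa Cc ->]]] := dec m.
  by rewrite left_componentM // => ->; rewrite mul1g.
by rewrite -[X in left_component _ _ X]mul1g left_componentM.
Qed.

(** Thus [q] reads off the [A]-factor of any product with a kernel element, which yields both the
    uniqueness of decompositions along [(A, Ker q)] and the injectivity of the kernel map. *)
Lemma cocycle_mul_ker A q a c : left_descent_cocycle A q -> A a ->
  cocycle_ker q c -> q (a * c) = a.
Proof. by move=> [_ _ qM _] Aa qc; rewrite qM // qc mulg1. Qed.

Lemma cocycle_ker_factorization A B q : factorization A B ->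
  left_descent_cocycle_unit_on A B q -> factorization A (cocycle_ker q).
Proof.
move=> /factorizationE[sA _ dec inj] [cq qU].
have [qA qid qM q3] := cq; have [A1 AM] := (submonoidE A).1 sA.
apply/factorizationE; split=> //.
- apply/submonoidE; split=> [|c c' qc qc']; first exact: qid.
  by rewrite /cocycle_ker /= q3 qc' mulg1.
- move=> m; have [a [b [Aa Bb ->]]] := dec m.
  have [Aqb [v Av [qbv vqb]]] : submonoid_units A (q b).
    by apply: qU; exists b.
  (* Since [v] is in [A], [q (v * b) = v * q b = 1]. *)
  exists (a * q b), (v * b); split; first exact: AM.
    by rewrite /cocycle_ker /= qM.
  by rewrite -!mulgA [q b * _]mulgA qbv mul1g.
move=> a c a' c' Aa qc Aa' qc' e.
have aa' : a = a'.
  by rewrite -(cocycle_mul_ker cq Aa qc) e (cocycle_mul_ker cq Aa' qc').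
split=> //; subst a'.
(* [A] need not be cancellative: the [A]-components of [c] and [c'] along
   [(A, B)] agree since both invert the unit [q b]. *)
have [x [b [Ax Bb cE]]] := dec c; have [y [b' [Ay Bb' cE']]] := dec c'.
move: e; rewrite cE cE' !mulgA => e.
have [_ bb'] := inj _ _ _ _ (AM _ _ Aa Ax) Bb (AM _ _ Aa Ay) Bb' e.
subst b'; congr (_ * _).
have [_ [v _ [qbv _]]] : submonoid_units A (q b) by apply: qU; exists b.
have xq : x * q b = 1 by rewrite -qM // -cE.
have yq : y * q b = 1 by rewrite -qM // -cE'.
by rewrite -[x]mulg1 -[y]mulg1 -qbv !mulgA xq yq.
Qed.

Lemma cocycle_ker_inj A q q' : factorization A (cocycle_ker q) ->
  left_descent_cocycle A q -> left_descent_cocycle A q' ->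
  cocycle_ker q = cocycle_ker q' -> q = q'.
Proof.
move=> /factorizationE[_ _ dec _] cq cq' e; apply/funext => m.
have [a [c [Aa qc ->]]] := dec m.
by rewrite (cocycle_mul_ker cq) // (cocycle_mul_ker cq') // -e.
Qed.

End Factorizations.

Theorem theorem2p18 (M : monoidType) (A B : set M)
    (facAB : factorization A B) :
  pointed_set_iso (left_descent_cocycle_unit_on A B) (left_component A B)
                  (FAC A) B
                  (@cocycle_ker M).
Proof.
(* Taking [C := B] gives the base point; arbitrary [C] gives the preimages for surjectivity. *)
have lcP C : factorization A C ->
    left_descent_cocycle_unit_on A B (left_component A C).
  move=> facAC; split; first exact: left_component_cocycle.
  exact: left_component_units.
split=> //; [exact: lcP | split | exact: cocycle_ker_left_component].
- by move=> q; apply: cocycle_ker_factorization.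
- move=> q q' /set_mem Dq /set_mem Dq'; apply: cocycle_ker_inj Dq.1 Dq'.1.
  exact: cocycle_ker_factorization Dq.
- move=> C facAC; exists (left_component A C); first exact: lcP.
  exact: cocycle_ker_left_component.
Qed.
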